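(* Let $\Bbbk$ be an algebraically closed field with $\mathrm{char}(\Bbbk)\neq2$ and $A$ a finite dimensional unital associative $\mathbb{Z}_2$-graded $\Bbbk$-algebra. There is an isomorphism of superalgebras $$\mathrm{End}^{\mathbf{\Pi}}(\Pi)\;\cong\;s\mathcal{Z}(A)^{\mathrm{op}}.$$
   Context: The super centre $s\mathcal{Z}(A)$ is the subalgebra of $A$ spanned by homogeneous $x$ with $xy=(-1)^{\partial x\,\partial y}yx$ for all homogeneous $y\in A$; ''op'' is the ordinary (unsigned) opposite algebra. $A\text{-gmod}$ is the category of finite dimensional $\mathbb{Z}_2$-graded left $A$-modules with degree-preserving $A$-linear maps. $\mathbf{\Pi}=\Pi_{\bar1}$ is the parity shift functor, $(\mathbf{\Pi}M)_i=M_{i+\bar1}$ with unchanged underlying module and maps, and $\Pi_{\bar0}=\mathrm{Id}$; $\mathbf{\Pi}^2=\mathrm{Id}$. $\mathrm{End}(\Pi)=\mathrm{Nat}(\mathrm{Id},\mathrm{Id})\oplus\mathrm{Nat}(\mathrm{Id},\mathbf{\Pi})$ is a $\mathbb{Z}_2$-graded algebra with product $\alpha\beta:=\Pi_k(\alpha)\circ\beta$ for $\alpha\in\mathrm{Nat}(\mathrm{Id},\Pi_h)$, $\beta\in\mathrm{Nat}(\mathrm{Id},\Pi_k)$. A $\mathbf{\Pi}$-functor on $A\text{-gmod}$ is a functor $F$ with a natural isomorphism $\xi^F:\mathbf{\Pi}\circ F\Rightarrow F\circ\mathbf{\Pi}$ such that $\xi^F_{\mathbf{\Pi}}\circ\mathbf{\Pi}(\xi^F)$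 is the identity of $F$ (using $\mathbf{\Pi}^2=\mathrm{Id}$). Convention: $\xi^{\mathrm{Id}}$ is the identity and $\xi^{\mathbf{\Pi}}$ is minus the identity. A $\mathbf{\Pi}$-natural transformation between $\mathbf{\Pi}$-functors $F,K$ is a natural transformation $\eta:F\Rightarrow K$ with $\eta_{\mathbf{\Pi}}\circ\xi^F=\xi^K\circ\mathbf{\Pi}(\eta)$; the space of these is $\mathrm{Nat}^{\mathbf{\Pi}}(F,K)$. $\mathrm{End}^{\mathbf{\Pi}}(\Pi)$ is the subalgebra $\mathrm{Nat}^{\mathbf{\Pi}}(\mathrm{Id},\mathrm{Id})\oplus\mathrm{Nat}^{\mathbf{\Pi}}(\mathrm{Id},\mathbf{\Pi})$ of $\mathrm{End}(\Pi)$. *)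

(* Defs.v *)
From HB Require Import structures.
From mathcomp Require Import all_boot all_algebra.
From mathcomp Require Import boolp.

Set Implicit Arguments.
Unset Strict Implicit.
Unset Printing Implicit Defensive.

Import GRing.Theory.
Local Open Scope ring_scope.
Local Obligation Tactic := idtac.

(* The group Z_2 is bool: false is 0, true is 1, addition is addb, and the
   product of two degrees is andb. *)

(* End(Pi) consists of families indexed by all graded modules, so its carrier
   is too large to be an algType k, the modules themselves being MathComp
   structures.  This record has its own universe level.  Negatives are
   (-1) x; sa_scale0 makes the additive monoid a group. *)
Record superalgebra (k : fieldType) := Superalgebra {
  sa_car :> Type;
  sa_zero : sa_car;
  sa_add : sa_car -> sa_car -> sa_car;
  sa_scale : k -> sa_car -> sa_car;
  sa_one : sa_car;
  sa_mul : sa_car -> sa_car -> sa_car;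
  sa_part : bool -> sa_car -> Prop;
  sa_addA : associative sa_add;
  sa_addC : commutative sa_add;
  sa_add0 : left_id sa_zero sa_add;
  sa_scale0 : forall x, sa_scale 0 x = sa_zero;
  sa_scale1 : forall x, sa_scale 1 x = x;
  sa_scaleA : forall c d x, sa_scale c (sa_scale d x) = sa_scale (c * d) x;
  sa_scaleDr : forall c x y,
    sa_scale c (sa_add x y) = sa_add (sa_scale c x) (sa_scale c y);
  sa_scaleDl : forall c d x,
    sa_scale (c + d) x = sa_add (sa_scale c x) (sa_scale d x);
  sa_mulA : associative sa_mul;
  sa_mul1l : left_id sa_one sa_mul;
  sa_mul1r : right_id sa_one sa_mul;
  sa_mulDl : left_distributive sa_mul sa_add;
  sa_mulDr : right_distributive sa_mul sa_add;
  sa_scaleAl : forall c x y, sa_scale c (sa_mul x y) = sa_mul (sa_scale c x) y;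
  sa_scaleAr : forall c x y, sa_scale c (sa_mul x y) = sa_mul x (sa_scale c y);
  sa_part_add : forall i x y,
    sa_part i x -> sa_part i y -> sa_part i (sa_add x y);
  sa_part_scale : forall i c x, sa_part i x -> sa_part i (sa_scale c x);
  sa_part_span : forall x, exists x0 x1,
    [/\ sa_part false x0, sa_part true x1 & x = sa_add x0 x1];
  sa_part_direct : forall x, sa_part false x -> sa_part true x -> x = sa_zero;
  sa_part_mul : forall i j x y,
    sa_part i x -> sa_part j y -> sa_part (i (+) j) (sa_mul x y)
}.

Definition superalg_iso (k : fieldType) (B C : superalgebra k) : Prop :=
  exists f : B -> C,
    [/\ bijective f,
        forall x y, f (sa_add x y) = sa_add (f x) (f y)
      & forall c x, f (sa_scale c x) = sa_scale c (f x)] /\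
    [/\ f (sa_one B) = sa_one C,
        forall x y, f (sa_mul x y) = sa_mul (f x) (f y)
      & forall i x, sa_part i x -> sa_part i (f x)].

Program Definition op_superalgebra (k : fieldType) (B : superalgebra k) :
    superalgebra k :=
  @Superalgebra k B (sa_zero B) (@sa_add k B) (@sa_scale k B) (sa_one B)
    (fun x y => sa_mul y x) (@sa_part k B) (@sa_addA k B) (@sa_addC k B)
    (@sa_add0 k B) (@sa_scale0 k B) (@sa_scale1 k B) (@sa_scaleA k B)
    (@sa_scaleDr k B) (@sa_scaleDl k B) _ (@sa_mul1r k B) (@sa_mul1l k B)
    _ _ _ _ (@sa_part_add k B) (@sa_part_scale k B) (@sa_part_span k B)
    (@sa_part_direct k B) _.
Next Obligation. by move=> k B x y z; rewrite sa_mulA. Qed.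
Next Obligation. by move=> k B x y z; rewrite sa_mulDr. Qed.
Next Obligation. by move=> k B x y z; rewrite sa_mulDl. Qed.
Next Obligation. by move=> k B c x y; rewrite sa_scaleAr. Qed.
Next Obligation. by move=> k B c x y; rewrite sa_scaleAl. Qed.
Next Obligation.
by move=> k B i j x y hx hy; rewrite addbC; apply: sa_part_mul.
Qed.

Record subsuper (k : fieldType) (B : superalgebra k) (P : B -> Prop) : Prop :=
  Subsuper {
  ss_add : forall x y, P x -> P y -> P (sa_add x y);
  ss_scale : forall c x, P x -> P (sa_scale c x);
  ss_one : P (sa_one B);
  ss_mul : forall x y, P x -> P y -> P (sa_mul x y);
  ss_span : forall x, P x -> exists x0 x1,
    [/\ P x0 /\ sa_part false x0, P x1 /\ sa_part true x1 & x = sa_add x0 x1]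
}.

Lemma ss_zero (k : fieldType) (B : superalgebra k) (P : B -> Prop) :
  subsuper P -> P (sa_zero B).
Proof.
move=> h; rewrite -(sa_scale0 (sa_one B)).
by apply: (ss_scale h); apply: ss_one h.
Qed.

Lemma sub_ext (T : Type) (P : T -> Prop) (x y : {z | P z}) :
  sval x = sval y -> x = y.
Proof.
case: x y => [x hx] [y hy] /= e; case: _ / e hy => hy.
by rewrite (Prop_irrelevance hx hy).
Qed.

Program Definition sub_superalgebra (k : fieldType) (B : superalgebra k)
    (P : B -> Prop) (h : subsuper P) : superalgebra k :=
  @Superalgebra k {x : B | P x}
    (exist _ (sa_zero B) (ss_zero h))
    (fun x y =>
       exist _ (sa_add (sval x) (sval y)) (ss_add h (svalP x) (svalP y)))
    (fun c x => exist _ (sa_scale c (sval x)) (ss_scale h c (svalP x)))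
    (exist _ (sa_one B) (ss_one h))
    (fun x y =>
       exist _ (sa_mul (sval x) (sval y)) (ss_mul h (svalP x) (svalP y)))
    (fun i x => sa_part i (sval x))
    _ _ _ _ _ _ _ _ _ _ _ _ _ _ _ _ _ _ _ _.
Next Obligation. by move=> k B P h x y z; apply/sub_ext/sa_addA. Qed.
Next Obligation. by move=> k B P h x y; apply/sub_ext/sa_addC. Qed.
Next Obligation. by move=> k B P h x; apply/sub_ext/sa_add0. Qed.
Next Obligation. by move=> k B P h x; apply/sub_ext/sa_scale0. Qed.
Next Obligation. by move=> k B P h x; apply/sub_ext/sa_scale1. Qed.
Next Obligation. by move=> k B P h c d x; apply/sub_ext/sa_scaleA. Qed.
Next Obligation. by move=> k B P h c x y; apply/sub_ext/sa_scaleDr. Qed.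
Next Obligation. by move=> k B P h c d x; apply/sub_ext/sa_scaleDl. Qed.
Next Obligation. by move=> k B P h x y z; apply/sub_ext/sa_mulA. Qed.
Next Obligation. by move=> k B P h x; apply/sub_ext/sa_mul1l. Qed.
Next Obligation. by move=> k B P h x; apply/sub_ext/sa_mul1r. Qed.
Next Obligation. by move=> k B P h x y z; apply/sub_ext/sa_mulDl. Qed.
Next Obligation. by move=> k B P h x y z; apply/sub_ext/sa_mulDr. Qed.
Next Obligation. by move=> k B P h c x y; apply/sub_ext/sa_scaleAl. Qed.
Next Obligation. by move=> k B P h c x y; apply/sub_ext/sa_scaleAr. Qed.
Next Obligation. by move=> k B P h i x y; apply: sa_part_add. Qed.
Next Obligation. by move=> k B P h i c x; apply: sa_part_scale. Qed.
Next Obligation.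
move=> k B P h [x hx]; have [x0 [x1 [[p0 d0] [p1 d1] e]]] := ss_span h hx.
by exists (exist _ x0 p0), (exist _ x1 p1); split=> //; apply: sub_ext.
Qed.
Next Obligation. by move=> k B P h x h0 h1; apply/sub_ext/sa_part_direct. Qed.
Next Obligation. by move=> k B P h i j x y; apply: sa_part_mul. Qed.

Definition is_grading (k : fieldType) (V : zmodType) (sc : k -> V -> V)
    (P : bool -> V -> Prop) : Prop :=
  [/\ forall i x y, P i x -> P i y -> P i (x + y),
      forall i c x, P i x -> P i (sc c x),
      forall x, exists x0 x1, [/\ P false x0, P true x1 & x = x0 + x1]
    & forall x, P false x -> P true x -> x = 0].

Definition fin_spanned (k : fieldType) (V : zmodType) (sc : k -> V -> V) :
    Prop :=
  exists n (b : 'I_n -> V),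
    forall x, exists c : 'I_n -> k, x = \sum_(i < n) sc (c i) (b i).

(* A k-algebra is a ring with a central morphism from k; unlike algType k,
   this allows the zero algebra. *)
Record galgebra (k : fieldType) := Galgebra {
  ga_ring :> pzRingType;
  ga_in : {rmorphism k -> ga_ring};
  ga_central : forall c x, ga_in c * x = x * ga_in c;
  ga_part : bool -> ga_ring -> Prop;
  ga_grading : is_grading (fun c x => ga_in c * x) ga_part;
  ga_mul : forall i j x y,
    ga_part i x -> ga_part j y -> ga_part (i (+) j) (x * y)
}.

Definition fin_dim (k : fieldType) (A : galgebra k) : Prop :=
  fin_spanned (fun (c : k) (x : A) => ga_in A c * x).

Program Definition super_of (k : fieldType) (A : galgebra k) : superalgebra k :=
  @Superalgebra k A 0 (fun x y => x + y) (fun c x => ga_in A c * x) 1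
    (fun x y => x * y) (@ga_part k A)
    _ _ _ _ _ _ _ _ _ _ _ _ _ _ _ _ _ _ _ (@ga_mul k A).
Next Obligation. by move=> k A; exact: addrA. Qed.
Next Obligation. by move=> k A; exact: addrC. Qed.
Next Obligation. by move=> k A; exact: add0r. Qed.
Next Obligation. by move=> k A x /=; rewrite rmorph0 mul0r. Qed.
Next Obligation. by move=> k A x /=; rewrite rmorph1 mul1r. Qed.
Next Obligation. by move=> k A c d x /=; rewrite mulrA rmorphM. Qed.
Next Obligation. by move=> k A c x y /=; rewrite mulrDr. Qed.
Next Obligation. by move=> k A c d x /=; rewrite rmorphD mulrDl. Qed.
Next Obligation. by move=> k A; exact: mulrA. Qed.
Next Obligation. by move=> k A; exact: mul1r. Qed.
Next Obligation. by move=> k A; exact: mulr1. Qed.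
Next Obligation. by move=> k A; exact: mulrDl. Qed.
Next Obligation. by move=> k A; exact: mulrDr. Qed.
Next Obligation. by move=> k A c x y /=; rewrite mulrA. Qed.
Next Obligation. by move=> k A c x y /=; rewrite !mulrA ga_central. Qed.
Next Obligation. by move=> k A; case: (ga_grading A). Qed.
Next Obligation. by move=> k A; case: (ga_grading A). Qed.
Next Obligation. by move=> k A; case: (ga_grading A). Qed.
Next Obligation. by move=> k A; case: (ga_grading A). Qed.

Lemma ga_part0 (k : fieldType) (A : galgebra k) i : ga_part i (0 : A).
Proof.
have [_ hZ hS _] := ga_grading A; have [x0 [x1 [h0 h1 _]]] := hS 0.
by rewrite -(mul0r (if i then x1 else x0)) -(rmorph0 (ga_in A));
  apply: hZ; case: i.
Qed.

Lemma ga_one (k : fieldType) (A : galgebra k) : ga_part false (1 : A).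
Proof.
have [hD hZ hS hI] := ga_grading A; have [e0 [e1 [h0 h1 e]]] := hS 1.
have hom i (x : A) : ga_part i x -> e1 * x = 0.
  move=> hx; have ex : e1 * x = x - e0 * x.
    by rewrite -[X in X - _]mul1r e mulrDl addrAC subrr add0r.
  have hN (y : A) : ga_part i y -> ga_part i (- y).
    move=> hy; suff -> : - y = ga_in A (-1) * y by apply: hZ.
    by rewrite rmorphN rmorph1 mulN1r.
  have a0 : ga_part i (e1 * x).
    by rewrite ex; apply: (hD) => //; apply: hN; apply: (ga_mul h0 hx).
  have a1 : ga_part (~~ i) (e1 * x) by apply: (ga_mul h1 hx).
  by case: i a0 a1 {hx hN} => /= a0 a1; apply: hI.
suff e10 : e1 = 0 by rewrite e e10 addr0.
by rewrite -[e1]mulr1 e mulrDr (hom _ _ h0) (hom _ _ h1) addr0.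
Qed.

(* The degree of x is unique unless x = 0. *)
Definition supercentral (k : fieldType) (A : galgebra k) (x : A) : Prop :=
  exists2 i, ga_part i x &
    forall j y, ga_part j y -> x * y = (-1) ^+ (i && j) * (y * x).

Definition scentre_pred (k : fieldType) (A : galgebra k) (x : super_of A) :
    Prop :=
  exists n (c : 'I_n -> k) (z : 'I_n -> A),
    (forall i, supercentral (z i)) /\ x = \sum_(i < n) ga_in A (c i) * z i :> A.

Section ScentreClosed.
Variables (k : fieldType) (A : galgebra k).
Implicit Types x y : A.

Let sc i x := ga_part i x /\
  forall j y, ga_part j y -> x * y = (-1) ^+ (i && j) * (y * x).

Let scD i x y : sc i x -> sc i y -> sc i (x + y).
Proof.
have [hD _ _ _] := ga_grading A.
move=> [hx cx] [hy cy]; split=> [|j z hz]; first exact: hD.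
by rewrite mulrDl (cx _ _ hz) (cy _ _ hz) -mulrDr -mulrDr.
Qed.

Let sc0 i : sc i 0.
Proof. by split=> [|j z hz]; [exact: ga_part0 | rewrite mul0r !mulr0]. Qed.

Let scZ i c x : sc i x -> sc i (ga_in A c * x).
Proof.
have [_ hZ _ _] := ga_grading A.
move=> [hx cx]; split=> [|j z hz]; first exact: hZ.
rewrite -mulrA (cx _ _ hz) mulrA ga_central -!mulrA; congr (_ * _).
by rewrite -ga_central mulrA.
Qed.

Let scM i j x y : sc i x -> sc j y -> sc (i (+) j) (x * y).
Proof.
move=> [hx cx] [hy cy]; split=> [|l z hz]; first exact: ga_mul.
rewrite -mulrA (cy _ _ hz) [LHS]mulrA (commr_sign x) -[LHS]mulrA.
rewrite [x * (z * y)]mulrA.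
rewrite (cx _ _ hz) -!mulrA mulrA -signr_addb; congr (_ ^+ _ * _).
by case: i j l {hx cx hy cy hz} => [] [] [].
Qed.

Lemma scentreP x : @scentre_pred k A x <->
  exists x0 x1, [/\ sc false x0, sc true x1 & x = x0 + x1].
Proof.
split=> [[n [c [z [hz ->]]]] | [x0 [x1 [h0 h1 ->]]]].
  elim: n c z hz => [|n IH] c z hz.
    by exists 0, 0; rewrite big_ord0 addr0; split.
  rewrite big_ord_recl.
  have [x0 [x1 [h0 h1 ->]]] := IH (c \o lift ord0) (z \o lift ord0)
    (fun i => hz (lift ord0 i)).
  have [[] hi ci] := hz ord0.
    exists x0, (ga_in A (c ord0) * z ord0 + x1); split=> //.
      by apply: scD => //; apply: scZ.
    by rewrite addrCA.
  exists (ga_in A (c ord0) * z ord0 + x0), x1; split=> //.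
    by apply: scD => //; apply: scZ.
  by rewrite addrA.
exists 2, (fun=> 1), (fun i => if i == ord0 then x0 else x1); split.
  move=> i; case: ifP => _; [exists false | exists true].
  1,2: by case: h0.
  1,2: by case: h1.
by rewrite !big_ord_recl big_ord0 /= rmorph1 !mul1r addr0.
Qed.

Lemma scentre_subsuper : subsuper (@scentre_pred k A).
Proof.
split.
- move=> x y /scentreP [x0 [x1 [h0 h1 ->]]] /scentreP [y0 [y1 [g0 g1 ->]]].
  apply/scentreP; exists (x0 + y0), (x1 + y1); split; [exact: scD|exact: scD|].
  by rewrite /= addrACA.
- move=> c x /scentreP [x0 [x1 [h0 h1 ->]]].
  apply/scentreP; exists (ga_in A c * x0), (ga_in A c * x1).
  by split; [exact: scZ|exact: scZ|rewrite /= mulrDr].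
- apply/scentreP; exists 1, 0; split=> //; last by rewrite addr0.
  by split=> [|j y _]; [exact: ga_one | rewrite mul1r mulr1 expr0 mul1r].
- move=> x y /scentreP [x0 [x1 [h0 h1 ->]]] /scentreP [y0 [y1 [g0 g1 ->]]].
  apply/scentreP; exists (x0 * y0 + x1 * y1), (x0 * y1 + x1 * y0); split.
  + by apply: scD; [exact: (scM h0 g0) | exact: (scM h1 g1)].
  + by apply: scD; [exact: (scM h0 g1) | exact: (scM h1 g0)].
  by rewrite /= mulrDl !mulrDr [x1 * y0 + _]addrC addrACA.
move=> x /scentreP [x0 [x1 [h0 h1 ->]]]; exists x0, x1; split=> //; split.
- by apply/scentreP; exists x0, 0; rewrite addr0; split.
- by case: h0.
- by apply/scentreP; exists 0, x1; rewrite add0r; split.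
- by case: h1.
Qed.

End ScentreClosed.

Definition scentre (k : fieldType) (A : galgebra k) : superalgebra k :=
  sub_superalgebra (scentre_subsuper A).

Record gmod (k : fieldType) (A : galgebra k) := Gmod {
  gm_car :> lmodType A;
  gm_part : bool -> gm_car -> Prop;
  gm_grading : is_grading (fun c (m : gm_car) => ga_in A c *: m) gm_part;
  gm_act : forall i j a m,
    ga_part i a -> gm_part j m -> gm_part (i (+) j) (a *: m);
  gm_fin : fin_spanned (fun (c : k) (m : gm_car) => ga_in A c *: m)
}.

Record ghom (k : fieldType) (A : galgebra k) (M N : gmod A) := Ghom {
  gh_fun :> M -> N;
  gh_linear : linear gh_fun;
  gh_part : forall i m, gm_part i m -> gm_part i (gh_fun m)
}.

Lemma ghom_ext (k : fieldType) (A : galgebra k) (M N : gmod A)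
  (f g : ghom M N) : f =1 g -> f = g.
Proof.
case: f g => [f lf pf] [g lg pg] /= /funext e.
by case: _ / e lg pg => lg pg; congr Ghom; exact: Prop_irrelevance.
Qed.

Lemma id_linear (k : fieldType) (A : galgebra k) (M : gmod A) :
  linear (fun m : M => m).
Proof. by []. Qed.

Definition ghom_id (k : fieldType) (A : galgebra k) (M : gmod A) : ghom M M :=
  @Ghom k A M M (fun m => m) (@id_linear k A M) (fun i m h => h).

Program Definition ghom_comp (k : fieldType) (A : galgebra k) (M N P : gmod A)
    (g : ghom N P) (f : ghom M N) : ghom M P :=
  @Ghom k A M P (fun m => g (f m)) _ _.
Next Obligation.
by move=> k A M N P g f a x y /=; rewrite (gh_linear f) (gh_linear g).
Qed.
Next Obligation.
by move=> k A M N P g f i m h; apply: (gh_part g); apply: (gh_part f).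
Qed.

Record gfunctor (k : fieldType) (A : galgebra k) := Gfunctor {
  fobj :> gmod A -> gmod A;
  fmap : forall M N, ghom M N -> ghom (fobj M) (fobj N);
  fmap_id : forall M, fmap (ghom_id M) = ghom_id (fobj M);
  fmap_comp : forall M N P (g : ghom N P) (f : ghom M N),
    fmap (ghom_comp g f) = ghom_comp (fmap g) (fmap f)
}.

Definition functor_id (k : fieldType) (A : galgebra k) : gfunctor A :=
  @Gfunctor k A (fun M => M) (fun M N f => f) (fun M => erefl)
    (fun M N P g f => erefl).

Program Definition functor_comp (k : fieldType) (A : galgebra k)
    (G F : gfunctor A) : gfunctor A :=
  @Gfunctor k A (fun M => G (F M)) (fun M N f => fmap G (fmap F f)) _ _.
Next Obligation. by move=> k A G F M /=; rewrite !fmap_id. Qed.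
Next Obligation. by move=> k A G F M N P g f /=; rewrite !fmap_comp. Qed.

Program Definition shift_obj (k : fieldType) (A : galgebra k) (M : gmod A) :
    gmod A :=
  @Gmod k A (gm_car M) (fun i => gm_part (i (+) true)) _ _ (@gm_fin k A M).
Next Obligation.
move=> k A M; have [hD hZ hS hI] := gm_grading M; split.
- by move=> i; apply: hD.
- by move=> i; apply: hZ.
- move=> x; have [x0 [x1 [h0 h1 ->]]] := hS x.
  by exists x1, x0; rewrite addrC.
by move=> x h1 h0; apply: hI.
Qed.
Next Obligation.
by move=> k A M i j a m hi hj /=; rewrite -addbA; apply: gm_act.
Qed.

Definition shift_hom (k : fieldType) (A : galgebra k) (M N : gmod A)
    (f : ghom M N) : ghom (shift_obj M) (shift_obj N) :=
  @Ghom k A (shift_obj M) (shift_obj N) f (@gh_linear k A M N f)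
    (fun i m => @gh_part k A M N f (i (+) true) m).

Program Definition shift (k : fieldType) (A : galgebra k) : gfunctor A :=
  @Gfunctor k A (@shift_obj k A) (@shift_hom k A) _ _.
Next Obligation. by move=> k A M; apply: ghom_ext. Qed.
Next Obligation. by move=> k A M N P g f; apply: ghom_ext. Qed.

Definition Pi (k : fieldType) (A : galgebra k) (h : bool) : gfunctor A :=
  if h then shift A else functor_id A.

(* The double shift of M has the same underlying module and grading as M, but
   in a different syntactic form; the identification of Pi^2 with the identity
   functor is made through these two identity maps. *)
Program Definition to_shift2 (k : fieldType) (A : galgebra k) (M : gmod A) :
    ghom M (shift_obj (shift_obj M)) :=
  @Ghom k A M (shift_obj (shift_obj M)) (fun m => m) (@id_linear k A M) _.
Next Obligation. by move=> k A M i m h /=; rewrite -addbA addbF. Qed.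

Program Definition of_shift2 (k : fieldType) (A : galgebra k) (M : gmod A) :
    ghom (shift_obj (shift_obj M)) M :=
  @Ghom k A (shift_obj (shift_obj M)) M (fun m => m) (@id_linear k A M) _.
Next Obligation. by move=> k A M i m /=; rewrite -addbA addbF. Qed.

Record gnat (k : fieldType) (A : galgebra k) (F G : gfunctor A) := Gnat {
  ncomp :> forall M, ghom (F M) (G M);
  nnat : forall M N (f : ghom M N),
    ghom_comp (ncomp N) (fmap F f) = ghom_comp (fmap G f) (ncomp M)
}.

Lemma gnat_ext (k : fieldType) (A : galgebra k) (F G : gfunctor A)
  (a b : gnat F G) : (forall M, a M =1 b M) -> a = b.
Proof.
case: a b => [a na] [b nb] /= e.
have {}e : a = b.
  by apply: functional_extensionality_dep => M; apply/ghom_ext/e.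
by case: _ / e nb => nb; congr Gnat; exact: Prop_irrelevance.
Qed.

Lemma nnatE (k : fieldType) (A : galgebra k) (F G : gfunctor A)
  (a : gnat F G) M N (f : ghom M N) x : a N (fmap F f x) = fmap G f (a M x).
Proof. by have := congr1 (fun h : ghom _ _ => h x) (nnat a f). Qed.

Section GhomLinear.
Variables (k : fieldType) (A : galgebra k) (M N : gmod A) (f : ghom M N).

Lemma ghomD x y : f (x + y) = f x + f y.
Proof. by have := gh_linear f 1 x y; rewrite !scale1r. Qed.

Lemma ghom0 : f 0 = 0.
Proof. by apply: (addrI (f 0)); rewrite -ghomD !addr0. Qed.

Lemma ghomZ a x : f (a *: x) = a *: f x.
Proof. by have := gh_linear f a x 0; rewrite !addr0 ghom0 addr0. Qed.

Lemma ghomN x : f (- x) = - f x.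
Proof. by rewrite -scaleN1r ghomZ scaleN1r. Qed.

End GhomLinear.

Lemma gm_part0 (k : fieldType) (A : galgebra k) (M : gmod A) i :
  gm_part i (0 : M).
Proof.
have [_ hZ hS _] := gm_grading M; have [x0 [x1 [h0 h1 _]]] := hS 0.
rewrite -(scale0r (if i then x1 else x0)) -(rmorph0 (ga_in A)).
by apply: hZ; case: i.
Qed.

Program Definition ghom_zero (k : fieldType) (A : galgebra k) (M N : gmod A) :
    ghom M N := @Ghom k A M N (fun=> 0) _ _.
Next Obligation. by move=> k A M N a x y; rewrite scaler0 addr0. Qed.
Next Obligation. by move=> k A M N i m _; exact: gm_part0. Qed.

Program Definition ghom_add (k : fieldType) (A : galgebra k) (M N : gmod A)
    (f g : ghom M N) : ghom M N := @Ghom k A M N (fun m => f m + g m) _ _.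
Next Obligation.
move=> k A M N f g a x y /=.
by rewrite (gh_linear f) (gh_linear g) scalerDr addrACA.
Qed.
Next Obligation.
move=> k A M N f g i m h; have [hD _ _ _] := gm_grading N.
by apply: hD; apply: gh_part.
Qed.

Program Definition ghom_scale (k : fieldType) (A : galgebra k) (M N : gmod A)
    (c : k) (f : ghom M N) : ghom M N :=
  @Ghom k A M N (fun m => ga_in A c *: f m) _ _.
Next Obligation.
move=> k A M N c f a x y /=.
by rewrite (gh_linear f) scalerDr !scalerA ga_central.
Qed.
Next Obligation.
move=> k A M N c f i m h; have [_ hZ _ _] := gm_grading N.
by apply: hZ; apply: gh_part.
Qed.

Program Definition nat_zero (k : fieldType) (A : galgebra k)
    (F G : gfunctor A) : gnat F G :=
  @Gnat k A F G (fun M => ghom_zero (F M) (G M)) _.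
Next Obligation.
by move=> k A F G M N f; apply: ghom_ext => x /=; rewrite ghom0.
Qed.

Program Definition nat_add (k : fieldType) (A : galgebra k)
    (F G : gfunctor A) (a b : gnat F G) : gnat F G :=
  @Gnat k A F G (fun M => ghom_add (a M) (b M)) _.
Next Obligation.
by move=> k A F G a b M N f; apply: ghom_ext => x /=; rewrite ghomD !nnatE.
Qed.

Program Definition nat_scale (k : fieldType) (A : galgebra k)
    (F G : gfunctor A) (c : k) (a : gnat F G) : gnat F G :=
  @Gnat k A F G (fun M => ghom_scale c (a M)) _.
Next Obligation.
by move=> k A F G c a M N f; apply: ghom_ext => x /=; rewrite ghomZ nnatE.
Qed.

Program Definition nat_id (k : fieldType) (A : galgebra k) (F : gfunctor A) :
    gnat F F := @Gnat k A F F (fun M => ghom_id (F M)) _.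
Next Obligation. by move=> k A F M N f; apply: ghom_ext. Qed.

(* Components of Pi_l Pi_h = Pi_(h+l), using Pi^2 = Id. *)
Definition merge_comp (k : fieldType) (A : galgebra k) (h l : bool)
    (M : gmod A) :
    ghom (Pi A l (Pi A h M)) (Pi A (h (+) l) M) :=
  match h, l return ghom (Pi A l (Pi A h M)) (Pi A (h (+) l) M) with
  | true, true => of_shift2 M
  | true, false => ghom_id (shift A M)
  | false, true => ghom_id (shift A M)
  | false, false => ghom_id M
  end.

(* Pi_l(a) o b, read as a transformation into Pi_(h+l). *)
Program Definition homog_mul (k : fieldType) (A : galgebra k) (h l : bool)
    (a : gnat (functor_id A) (Pi A h)) (b : gnat (functor_id A) (Pi A l)) :
    gnat (functor_id A) (Pi A (h (+) l)) :=
  @Gnat k A (functor_id A) (Pi A (h (+) l))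
    (fun M => ghom_comp (merge_comp h l M)
                (ghom_comp (fmap (Pi A l) (a M)) (b M))) _.
Next Obligation.
move=> k A h l a b M N f; apply: ghom_ext => x.
have ea y : a N (f y) = fmap (Pi A h) f (a M y) := nnatE a f y.
have eb : b N (f x) = fmap (Pi A l) f (b M x) := nnatE b f x.
by case: h l a b ea eb => [] [] a b /= ea eb; rewrite eb ea.
Qed.

(* (a0, a1) stands for a0 + a1 with a0 even and a1 odd. *)
Definition End_car (k : fieldType) (A : galgebra k) : Type :=
  (gnat (functor_id A) (Pi A false) * gnat (functor_id A) (Pi A true))%type.

Definition End_mul (k : fieldType) (A : galgebra k) (a b : End_car A) :
    End_car A :=
  (nat_add (@homog_mul k A false false a.1 b.1)
           (@homog_mul k A true true a.2 b.2),
   nat_add (@homog_mul k A false true a.1 b.2)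
           (@homog_mul k A true false a.2 b.1)).

Lemma End_ext (k : fieldType) (A : galgebra k) (a b : End_car A) :
  (forall (M : gmod A) (x : M), a.1 M x = b.1 M x) ->
  (forall (M : gmod A) (x : M), a.2 M x = b.2 M x) -> a = b.
Proof.
case: a b => [a0 a1] [b0 b1] /= e0 e1.
by congr pair; apply: gnat_ext.
Qed.

Program Definition End_superalgebra (k : fieldType) (A : galgebra k) :
    superalgebra k :=
  @Superalgebra k (End_car A)
    (nat_zero _ _, nat_zero _ _)
    (fun a b => (nat_add a.1 b.1, nat_add a.2 b.2))
    (fun c a => (nat_scale c a.1, nat_scale c a.2))
    (nat_id (functor_id A), nat_zero _ _)
    (@End_mul k A)
    (fun i a => if i then a.1 = nat_zero _ _ else a.2 = nat_zero _ _)
    _ _ _ _ _ _ _ _ _ _ _ _ _ _ _ _ _ _ _ _.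
Next Obligation. by move=> k A a b c; apply: End_ext => M x /=; rewrite addrA. Qed.
Next Obligation. by move=> k A a b; apply: End_ext => M x /=; rewrite addrC. Qed.
Next Obligation. by move=> k A a; apply: End_ext => M x /=; rewrite add0r. Qed.
Next Obligation.
by move=> k A a; apply: End_ext => M x /=; rewrite rmorph0 scale0r.
Qed.
Next Obligation.
by move=> k A a; apply: End_ext => M x /=; rewrite rmorph1 scale1r.
Qed.
Next Obligation.
by move=> k A c d a; apply: End_ext => M x /=; rewrite rmorphM scalerA.
Qed.
Next Obligation.
by move=> k A c a b; apply: End_ext => M x /=; rewrite scalerDr.
Qed.
Next Obligation.
by move=> k A c d a; apply: End_ext => M x /=; rewrite rmorphD scalerDl.
Qed.
Next Obligation.
by move=> k A a b c; apply: End_ext => M x /=; rewrite !ghomD -!addrA;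
  congr (_ + _); rewrite [RHS]addrCA; congr (_ + _); exact: addrC.
Qed.
Next Obligation.
by move=> k A a; apply: End_ext => M x /=; rewrite ?addr0.
Qed.
Next Obligation.
by move=> k A a; apply: End_ext => M x /=; rewrite ghom0 ?addr0 ?add0r.
Qed.
Next Obligation.
by move=> k A a b c; apply: End_ext => M x /=; rewrite addrACA.
Qed.
Next Obligation.
by move=> k A a b c; apply: End_ext => M x /=; rewrite !ghomD addrACA.
Qed.
Next Obligation.
by move=> k A c a b; apply: End_ext => M x /=; rewrite scalerDr.
Qed.
Next Obligation.
by move=> k A c a b; apply: End_ext => M x /=; rewrite !ghomZ scalerDr.
Qed.
Next Obligation.
by move=> k A [] a b /= -> ->; apply: gnat_ext => M x /=; rewrite addr0.
Qed.
Next Obligation.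
by move=> k A [] c a /= ->; apply: gnat_ext => M x /=; rewrite scaler0.
Qed.
Next Obligation.
move=> k A a; exists (a.1, nat_zero _ _), (nat_zero _ _, a.2); split=> //.
by apply: End_ext => M x /=; rewrite ?addr0 ?add0r.
Qed.
Next Obligation. by move=> k A [a0 a1] /= -> ->. Qed.
Next Obligation.
by move=> k A [] [] a b /= ha hb; apply: gnat_ext => M x /=;
  rewrite ha hb /= ?ghom0 addr0.
Qed.

(* In xi_invol, to_shift2 gives F = Pi^2 F on the left and F = F Pi^2 on the right:
   it says that xi_Pi o Pi(xi) : Pi^2 F => F Pi^2 is the identity of F. *)
Record pifunctor (k : fieldType) (A : galgebra k) := Pifunctor {
  pf_fun :> gfunctor A;
  xi : gnat (functor_comp (shift A) pf_fun) (functor_comp pf_fun (shift A));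
  xi_iso : forall M, exists g,
    ghom_comp g (xi M) = ghom_id _ /\ ghom_comp (xi M) g = ghom_id _;
  xi_invol : forall M,
    ghom_comp (ghom_comp (xi (shift A M)) (fmap (shift A) (xi M)))
              (to_shift2 (pf_fun M))
    = fmap pf_fun (to_shift2 M)
}.

Program Definition pi_id (k : fieldType) (A : galgebra k) : pifunctor A :=
  @Pifunctor k A (functor_id A)
    (@Gnat k A (functor_comp (shift A) (functor_id A))
       (functor_comp (functor_id A) (shift A)) (fun M => ghom_id (shift A M)) _)
    _ _.
Next Obligation. by move=> k A M N f; apply: ghom_ext. Qed.
Next Obligation.
by move=> k A M; exists (ghom_id (shift A M)); split; apply: ghom_ext.
Qed.
Next Obligation. by move=> k A M; apply: ghom_ext. Qed.

Program Definition pi_shift (k : fieldType) (A : galgebra k) : pifunctor A :=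
  @Pifunctor k A (shift A)
    (nat_scale (-1) (nat_id (functor_comp (shift A) (shift A)))) _ _.
Next Obligation.
move=> k A M; exists (ghom_scale (-1) (ghom_id _)).
by split; apply: ghom_ext => x /=; rewrite rmorphN rmorph1 !scaleN1r opprK.
Qed.
Next Obligation.
move=> k A M; apply: ghom_ext => x /=.
by rewrite rmorphN rmorph1 !scaleN1r opprK.
Qed.

Definition pi_natural (k : fieldType) (A : galgebra k) (F K : pifunctor A)
    (eta : gnat F K) : Prop :=
  forall M, ghom_comp (eta (shift A M)) (xi F M)
            = ghom_comp (xi K M) (fmap (shift A) (eta M)).

Definition EndPi_pred (k : fieldType) (A : galgebra k)
    (a : End_superalgebra A) : Prop :=
  @pi_natural k A (pi_id A) (pi_id A) a.1 /\
  @pi_natural k A (pi_id A) (pi_shift A) a.2.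

Lemma EndPi_predP (k : fieldType) (A : galgebra k) (a : End_superalgebra A) :
  EndPi_pred a <->
  (forall (M : gmod A) (x : M), a.1 (shift_obj M) x = a.1 M x) /\
  (forall (M : gmod A) (x : M), a.2 (shift_obj M) x = - a.2 M x).
Proof.
have eN (M : gmod A) (y : M) : ga_in A (-1) *: y = - y.
  by rewrite rmorphN rmorph1 scaleN1r.
split=> [[h0 h1]|[h0 h1]]; split=> M.
- by move=> x; exact: (congr1 (fun f : ghom (shift_obj M) (shift_obj M) => f x) (h0 M)).
- move=> x; rewrite -eN.
  exact: (congr1
    (fun f : ghom (shift_obj M) (shift_obj (shift_obj M)) => f x) (h1 M)).
- by apply: ghom_ext => x; apply: h0.
by apply: ghom_ext => x /=; rewrite eN; apply: h1.
Qed.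

Lemma EndPi_subsuper (k : fieldType) (A : galgebra k) :
  subsuper (@EndPi_pred k A).
Proof.
split.
- move=> a b /EndPi_predP [a0 a1] /EndPi_predP [b0 b1]; apply/EndPi_predP.
  by split=> M x /=; rewrite ?a0 ?b0 ?a1 ?b1 // opprD.
- move=> c a /EndPi_predP [a0 a1]; apply/EndPi_predP.
  by split=> M x /=; rewrite ?a0 ?a1 ?scalerN.
- by apply/EndPi_predP; split=> M x /=; rewrite ?oppr0.
- move=> a b /EndPi_predP [a0 a1] /EndPi_predP [b0 b1]; apply/EndPi_predP.
  split=> M x /=.
    rewrite a0 b0 a1 b1; congr (_ + _).
    by rewrite ghomN opprK.
  rewrite a0 b1 a1 b0 opprD; congr (_ + _).
  by rewrite ghomN.
move=> a /EndPi_predP [a0 a1].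
exists ((a.1, nat_zero _ _) : End_car A), ((nat_zero _ _, a.2) : End_car A).
split; last by apply: End_ext => M x /=; rewrite ?addr0 ?add0r.
  split=> //; apply/EndPi_predP; split=> M x /=; first exact: a0.
  by rewrite oppr0.
by split=> //; apply/EndPi_predP; split=> M x //=; exact: a1.
Qed.

Definition EndPi (k : fieldType) (A : galgebra k) : superalgebra k :=
  sub_superalgebra (EndPi_subsuper A).

(* Main.v *)
(* A natural transformation is determined by its values at the generators of
   the regular module [A] and of its shift [Pi A], because a homogeneous [m] of
   degree [i] in [M] is the image of [1] under the morphism
   [Pi^i A -> M, r |-> r m].  Compatibility with [Pi] makes the value at
   [Pi A] agree with the value [z] at [A] up to a sign, so an even
   transformation is [m |-> z m] and an odd one is [m |-> (-1)^|m| z m]; the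
   linearity of these maps on [A] is exactly supercentrality of [z].
   Evaluation at [1] reverses products, since
   [a (b 1) = a (b 1 * 1) = b 1 * a 1]. *)
Require Import Defs.
From mathcomp Require Import all_boot all_algebra.
From mathcomp Require Import boolp.
Import GRing.Theory.
Local Open Scope ring_scope.

(** * The parity involution of a graded module *)

Section GradedModules.
Context {k : fieldType} {A : galgebra k}.
Implicit Types M N : gmod A.

Lemma gm_partD M i (x y : M) : gm_part i x -> gm_part i y -> gm_part i (x + y).
Proof. by have [hD _ _ _] := gm_grading M; apply: hD. Qed.

Lemma gm_partN M i (x : M) : gm_part i x -> gm_part i (- x).
Proof.
have [_ hZ _ _] := gm_grading M => hx.
by rewrite -scaleN1r -(rmorph1 (ga_in A)) -rmorphN; apply: hZ.
Qed.

(** The element [x0 - y0 = y1 - x1] lies in both homogeneous parts, hence vanishes. *)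
Lemma gm_part_unique M (x0 x1 y0 y1 : M) :
  gm_part false x0 -> gm_part true x1 -> gm_part false y0 -> gm_part true y1 ->
  x0 + x1 = y0 + y1 -> x0 = y0 /\ x1 = y1.
Proof.
have [_ _ _ hI] := gm_grading M => hx0 hx1 hy0 hy1 e.
have e01 : x0 - y0 = y1 - x1.
  apply/eqP; rewrite subr_eq addrAC eq_sym subr_eq; apply/eqP.
  by rewrite e addrC.
have e0 : x0 - y0 = 0.
  apply: hI; last rewrite e01; apply: gm_partD => //; exact: gm_partN.
by split; apply/eqP; rewrite -subr_eq0 ?e0 // -opprB -e01 e0 oppr0.
Qed.

Lemma gm_sign_exists M (x : M) : exists y x0 x1 : M,
  [/\ gm_part false x0, gm_part true x1, x = x0 + x1 & y = x0 - x1].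
Proof.
have [_ _ hS _] := gm_grading M; have [x0 [x1 [h0 h1 e]]] := hS x.
by exists (x0 - x1), x0, x1.
Qed.

(** This is the parity involution [m |-> (-1)^|m| m]. The grading only asserts that components
    exist, so the value is chosen; [gm_signE] shows that it does not depend on the choice. *)
Definition gm_sign M (x : M) : M := sval (cid (gm_sign_exists M x)).

Lemma gm_signE M (x0 x1 : M) :
  gm_part false x0 -> gm_part true x1 -> gm_sign M (x0 + x1) = x0 - x1.
Proof.
move=> h0 h1; rewrite /gm_sign; case: cid => y /= [y0 [y1 [g0 g1 e ->]]].
by have [-> ->] := gm_part_unique _ _ _ _ _ h0 h1 g0 g1 e.
Qed.

Lemma gm_sign_homog M i (x : M) : gm_part i x -> gm_sign M x = (-1) ^+ i *: x.
Proof.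
case: i => hx; rewrite ?expr1 ?scaleN1r ?expr0 ?scale1r.
  by rewrite -{1}[x]add0r gm_signE ?sub0r //; exact: gm_part0.
by rewrite -{1}[x]addr0 gm_signE ?subr0 //; exact: gm_part0.
Qed.

Lemma gm_signD M (x y : M) : gm_sign M (x + y) = gm_sign M x + gm_sign M y.
Proof.
have [_ _ hS _] := gm_grading M.
have [x0 [x1 [h0 h1 ->]]] := hS x; have [y0 [y1 [g0 g1 ->]]] := hS y.
rewrite addrACA !gm_signE ?opprD 1?addrACA //; exact: gm_partD.
Qed.

(** On a component of degree [j] the product has degree [i (+) j], and the sign of a sum of degrees
    is the product of the signs. *)
Lemma gm_sign_act M i (a : A) (x : M) :
  ga_part i a -> gm_sign M (a *: x) = (-1) ^+ i *: (a *: gm_sign M x).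
Proof.
have [_ _ hS _] := gm_grading M; have [x0 [x1 [h0 h1 ->]]] := hS x => ha.
rewrite scalerDr gm_signD gm_signE // scalerBr scalerBr.
rewrite (gm_sign_homog M _ _ (gm_act ha h0)).
rewrite (gm_sign_homog M _ _ (gm_act ha h1)) addbF signr_addb.
by rewrite mulrN1 scaleNr.
Qed.

Lemma gm_sign_ghom {M N} (f : ghom M N) (x : M) :
  f (gm_sign M x) = gm_sign N (f x).
Proof.
have [_ _ hS _] := gm_grading M; have [x0 [x1 [h0 h1 ->]]] := hS x.
by rewrite ghomD !gm_signE ?ghomD ?ghomN //; apply: gh_part.
Qed.

(** The shift exchanges the even and odd components. This sign matches the convention that the
    structure map of [pi_shift] is minus the identity. *)
Lemma gm_sign_shift M (x : M) : gm_sign (shift_obj M) x = - gm_sign M x.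
Proof.
have [_ _ hS _] := gm_grading M; have [x0 [x1 [h0 h1 ->]]] := hS x.
by rewrite (gm_signE M) // opprB [x0 + x1]addrC (gm_signE (shift_obj M)).
Qed.

End GradedModules.

(** * Evaluation at the unit of the regular module *)

Section Evaluation.
Context {k : fieldType} {A : galgebra k} (fdA : fin_dim A).
Implicit Types M N : gmod A.

Definition regular_gmod : gmod A :=
  @Gmod k A A^o (@ga_part k A) (ga_grading A) (@ga_mul k A) fdA.

Lemma orbit_linear M (m : M) : linear (fun r : regular_gmod => (r : A) *: m).
Proof. by move=> a x y; rewrite scalerDl scalerA. Qed.

Lemma orbit_even_part M (m : M) (hm : gm_part false m) i (r : A) :
  ga_part i r -> gm_part i (r *: m).
Proof. by move=> hr; have := gm_act hr hm; rewrite addbF. Qed.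

Definition orbit_even M (m : M) (hm : gm_part false m) : ghom regular_gmod M :=
  @Ghom k A regular_gmod M _ (orbit_linear M m) (orbit_even_part M m hm).

Lemma orbit_odd_part M (m : M) (hm : gm_part true m) i (r : A) :
  ga_part (i (+) true) r -> gm_part i (r *: m).
Proof. by move=> hr; have := gm_act hr hm; rewrite -addbA addbF. Qed.

Definition orbit_odd M (m : M) (hm : gm_part true m) :
    ghom (shift_obj regular_gmod) M :=
  @Ghom k A (shift_obj regular_gmod) M _ (orbit_linear M m)
    (orbit_odd_part M m hm).

Lemma nat_evenE (a : gnat (functor_id A) (Pi A false)) :
  (forall M (x : M), a (shift_obj M) x = a M x) ->
  forall M (m : M), a M m = (a regular_gmod 1 : A) *: m.
Proof.
move=> ha M m; have [_ _ hS _] := gm_grading M.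
have [m0 [m1 [h0 h1 ->]]] := hS m; rewrite ghomD scalerDr; congr (_ + _).
  by have := nnatE a (orbit_even M m0 h0) 1; rewrite /= scale1r.
(* Naturality gives the value of [a] at the unit of the shifted regular module; [ha] carries it back
   to the regular module. *)
by have := nnatE a (orbit_odd M m1 h1) 1; rewrite /= scale1r ha.
Qed.

Lemma nat_oddE (a : gnat (functor_id A) (Pi A true)) :
  (forall M (x : M), a (shift_obj M) x = - a M x) ->
  forall M (m : M), a M m = (a regular_gmod 1 : A) *: gm_sign M m.
Proof.
move=> ha M m; have [_ _ hS _] := gm_grading M.
have [m0 [m1 [h0 h1 ->]]] := hS m.
rewrite gm_signE // ghomD scalerBr; congr (_ + _).
  by have := nnatE a (orbit_even M m0 h0) 1; rewrite /= scale1r.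
(* The sign from [ha] is the one that [gm_sign] puts on the odd component. *)
by have := nnatE a (orbit_odd M m1 h1) 1; rewrite /= scale1r ha scaleNr.
Qed.

Lemma ghom_regularE M (f : ghom regular_gmod M) (x : A) : f x = x *: f 1.
Proof. by rewrite -ghomZ; congr (f _); rewrite [RHS]mulr1. Qed.

(** The unit is even. For [M] the shifted regular module, even degree in [M] means odd degree in
    [A]. *)
Lemma ghom_regular1 M (f : ghom regular_gmod M) : gm_part false (f 1).
Proof. by apply: gh_part; apply: ga_one. Qed.

Definition evaluate (a : End_superalgebra A) : A :=
  a.1 regular_gmod 1 + a.2 regular_gmod 1.

Lemma evaluate_mul (a b : End_superalgebra A) :
  evaluate (sa_mul a b) = evaluate b * evaluate a.
Proof.
rewrite /evaluate /=.
rewrite (ghom_regularE _ (a.1 regular_gmod) (b.1 regular_gmod 1)).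
rewrite (ghom_regularE _ (a.2 regular_gmod) (b.2 regular_gmod 1)).
rewrite (ghom_regularE _ (a.1 regular_gmod) (b.2 regular_gmod 1)).
rewrite (ghom_regularE _ (a.2 regular_gmod) (b.1 regular_gmod 1)).
by rewrite mulrDl !mulrDr addrACA [RHS]addrACA; congr (_ + _); exact: addrC.
Qed.

(** The value of a component at [y] is computed twice: linearity gives [y] times the value at 1,
    while [nat_evenE] or [nat_oddE] gives the value at 1 times [y], up to sign. *)
Lemma evaluate_scentre (a : End_superalgebra A) :
  EndPi_pred a -> scentre_pred (evaluate a).
Proof.
move=> /EndPi_predP [h0 h1]; apply/scentreP.
exists (a.1 regular_gmod 1), (a.2 regular_gmod 1); split=> //; split.
- exact: (ghom_regular1 _ (a.1 regular_gmod)).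
- move=> j y _; rewrite expr0 mul1r.
  rewrite -[RHS](ghom_regularE _ (a.1 regular_gmod)).
  by symmetry; apply: (nat_evenE _ h0 regular_gmod y).
- exact: (ghom_regular1 _ (a.2 regular_gmod)).
move=> j y hy; have e : y * a.2 regular_gmod 1
    = (a.2 regular_gmod 1 : A) * ((-1) ^+ j * y).
  rewrite -[LHS](ghom_regularE _ (a.2 regular_gmod)).
  rewrite -[(-1) ^+ j * y](gm_sign_homog regular_gmod j y hy).
  exact: (nat_oddE _ h1 regular_gmod y).
by rewrite e [X in _ = _ * X]mulrA commr_sign -mulrA signrMK.
Qed.

(** The two summands of [evaluate] have opposite degrees, so their sum determines each of them, and
    each determines its transformation. *)
Lemma evaluate_inj (a b : End_superalgebra A) :
  EndPi_pred a -> EndPi_pred b -> evaluate a = evaluate b -> a = b.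
Proof.
move=> /EndPi_predP [a0 a1] /EndPi_predP [b0 b1] e.
have [e0 e1] := gm_part_unique regular_gmod _ _ _ _
  (ghom_regular1 _ (a.1 regular_gmod))
  (ghom_regular1 _ (a.2 regular_gmod))
  (ghom_regular1 _ (b.1 regular_gmod))
  (ghom_regular1 _ (b.2 regular_gmod)) e.
apply: End_ext => M x; first
  by rewrite (nat_evenE _ a0) (nat_evenE _ b0 M x) e0.
by rewrite (nat_oddE _ a1) (nat_oddE _ b1 M x) e1.
Qed.

End Evaluation.

(** * Transformations given by supercentral elements *)

Section Multiplication.
Context {k : fieldType} {A : galgebra k} (z : A).
Implicit Types M N : gmod A.

Section Even.
Hypotheses (hz : ga_part false z)
  (cz : forall j y, ga_part j y -> z * y = (-1) ^+ (false && j) * (y * z)).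

Lemma even_supercentral_comm (y : A) : z * y = y * z.
Proof.
have [_ _ hS _] := ga_grading A; have [y0 [y1 [h0 h1 ->]]] := hS y.
by rewrite mulrDr mulrDl (cz _ _ h0) (cz _ _ h1) !mul1r.
Qed.

Lemma even_mul_linear M : linear (fun m : M => z *: m).
Proof.
by move=> a x y; rewrite scalerDr !scalerA even_supercentral_comm.
Qed.

Definition even_mul M : ghom M M :=
  @Ghom k A M M _ (even_mul_linear M) (fun i m hm => gm_act hz hm).

Lemma even_mul_natural M N (f : ghom M N) :
  ghom_comp (even_mul N) f = ghom_comp f (even_mul M).
Proof. by apply: ghom_ext => x /=; rewrite ghomZ. Qed.

Definition even_nat : gnat (functor_id A) (Pi A false) :=
  @Gnat k A (functor_id A) (functor_id A) even_mul even_mul_natural.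

End Even.

Section Odd.
Hypotheses (hz : ga_part true z)
  (cz : forall j y, ga_part j y -> z * y = (-1) ^+ (true && j) * (y * z)).

(** Moving [y] out of [gm_sign] and moving it past the odd [z] both cost [(-1) ^+ j], and the signs
    cancel. *)
Lemma odd_mul_homog M j (y : A) (x : M) :
  ga_part j y -> z *: gm_sign M (y *: x) = y *: (z *: gm_sign M x).
Proof.
move=> hy; rewrite (gm_sign_act M _ _ _ hy) [RHS]scalerA !scalerA.
by congr (_ *: _); rewrite commr_sign -mulrA (cz _ _ hy) signrMK.
Qed.

Lemma odd_mul_linear M :
  linear (fun m : M => z *: gm_sign M m : shift_obj M).
Proof.
have [_ _ hS _] := ga_grading A.
move=> a x y; rewrite gm_signD scalerDr; congr (_ + _).
(* Supercentrality speaks of homogeneous scalars only, so [a] is split. *)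
have [a0 [a1 [h0 h1 ->]]] := hS a; rewrite !scalerDl gm_signD scalerDr.
by rewrite (odd_mul_homog _ _ _ _ h0) (odd_mul_homog _ _ _ _ h1).
Qed.

Lemma odd_mul_part M i (m : M) :
  gm_part i m -> @gm_part k A (shift_obj M) i (z *: gm_sign M m).
Proof.
move=> hm /=; rewrite addbC; apply: gm_act => //.
rewrite (gm_sign_homog M i m hm); case: (i) {hm} (hm) => hm.
  by rewrite expr1 scaleN1r; apply: gm_partN.
by rewrite expr0 scale1r.
Qed.

Definition odd_mul M : ghom M (shift_obj M) :=
  @Ghom k A M (shift_obj M) _ (odd_mul_linear M) (odd_mul_part M).

Lemma odd_mul_natural M N (f : ghom M N) :
  ghom_comp (odd_mul N) f = ghom_comp (shift_hom f) (odd_mul M).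
Proof. by apply: ghom_ext => x /=; rewrite ghomZ gm_sign_ghom. Qed.

Definition odd_nat : gnat (functor_id A) (Pi A true) :=
  @Gnat k A (functor_id A) (shift A) odd_mul odd_mul_natural.

End Odd.
End Multiplication.

Lemma evaluate_surj {k : fieldType} {A : galgebra k} (fdA : fin_dim A) (z : A) :
  scentre_pred z ->
  exists a : End_superalgebra A, EndPi_pred a /\ evaluate fdA a = z.
Proof.
move=> /scentreP [z0 [z1 [[h0 c0] [h1 c1] ->]]].
exists (even_nat z0 h0 c0, odd_nat z1 h1 c1); split.
  by apply/EndPi_predP; split=> M x //=; rewrite gm_sign_shift scalerN.
(* Since 1 is even, the odd transformation takes the value [z1] there, without a sign. *)
rewrite /evaluate /= (gm_sign_homog (regular_gmod fdA) false 1 (ga_one A)) scale1r.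
by congr (_ + _); exact: mulr1.
Qed.

Theorem proposition47 (k : closedFieldType) (char_k : 2%N \notin [pchar k])
  (A : galgebra k) (fdA : fin_dim A) :
  superalg_iso (EndPi A) (op_superalgebra (scentre A)).
Proof.
pose f (a : EndPi A) : op_superalgebra (scentre A) :=
  exist _ (evaluate fdA (sval a)) (evaluate_scentre fdA _ (svalP a)).
have f_surj (z : op_superalgebra (scentre A)) : exists a, f a = z.
  have [a [ha e]] := evaluate_surj fdA _ (svalP z).
  by exists (exist _ a ha); apply: sub_ext.
have f_inj a b : f a = f b -> a = b.
  move=> /(congr1 sval) /= e; apply: sub_ext.
  exact: (evaluate_inj fdA _ _ (svalP a) (svalP b) e).
exists f; split; split.
- exists (fun z => sval (cid (f_surj z))) => x; last by case: cid.
  by apply: f_inj; case: cid.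
- by move=> a b; apply: sub_ext; rewrite /= /evaluate /= addrACA.
- by move=> c a; apply: sub_ext; rewrite /= /evaluate /= -scalerDr.
- by apply: sub_ext; rewrite /= /evaluate /= addr0.
- by move=> a b; apply: sub_ext; exact: evaluate_mul.
(* Homogeneity kills one summand of the evaluation; [ghom_regular1] gives the degree of the
   other. *)
move=> [] a /= e; rewrite /evaluate e /= ?addr0 ?add0r.
  exact: (ghom_regular1 fdA _ ((sval a).2 (regular_gmod fdA))).
exact: (ghom_regular1 fdA _ ((sval a).1 (regular_gmod fdA))).
Qed.
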